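(* Let $K\subset\mathbb{R}^d$ be a convex body and let $X_1,X_2,\dots$ be i.i.d. random points in $K$ with distribution $\mu$. Assume that there are positive numbers $\alpha,L,\varepsilon_0$ with $\varepsilon_0\le 1$ such that $$\mu\left(C_K(u,\varepsilon)\right)\ge L\varepsilon^\alpha\quad\text{for all }u\in\mathbb{S}^{d-1}\text{ and all }\varepsilon\in[0,\varepsilon_0].$$ Let $C>2\alpha^{-1}d^2\,8^{\frac{d-1}{2}}$ and, for $n\ge 2$, let $M=\left\lceil C\,n^{\frac{d-1}{\alpha}}(\ln n)^{\frac{\alpha-d+1}{\alpha}}\right\rceil$. Let $U_1,\dots,U_M$ be i.i.d. uniform random vectors on $\mathbb{S}^{d-1}$, independent of $X_1,\dots,X_n$, let $\hat K_n$ be the convex hull of $X_1,\dots,X_n$, and let $$\hat K_{n,M}=\left\{x\in\mathbb{R}^d:\langle U_j,x\rangle\le\max_{1\le i\le n}\langle U_j,X_i\rangle,\ \forall j=1,\dots,M\right\}.$$ Then, as $n\to\infty$, $$\mathsf{d}_{\mathsf H}(\hat K_{n,M},\hat K_n)=O_{\mathbb{P}}\left(\left(\frac{\ln n}{n}\right)^{1/\alpha}\right).$$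
   Context: $d$ is a positive integer. A convex body in $\mathbb{R}^d$ is a compact convex set with nonempty interior. $\mathbb{S}^{d-1}$ is the Euclidean unit sphere. $h_K(u)=\max\{\langle u,x\rangle:x\in K\}$ is the support function, and $C_K(u,\varepsilon)=\{x\in K:\langle u,x\rangle\ge h_K(u)-\varepsilon\}$. $\mathsf{d}_{\mathsf H}$ is the Hausdorff distance (with value $+\infty$ when $\hat K_{n,M}$ is unbounded). $Z_n=O_{\mathbb{P}}(v_n)$ means that $Z_n/v_n$ is bounded in probability. *)

(* Defs.v *)
From HB Require Import structures.
From mathcomp Require Import all_boot all_order all_algebra finmap.
From mathcomp Require Import all_classical all_reals all_analysis.

Set Implicit Arguments.
Unset Strict Implicit.
Unset Printing Implicit Defensive.

Import Order.TTheory GRing.Theory Num.Theory.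
Import numFieldNormedType.Exports.

Local Open Scope classical_set_scope.
Local Open Scope ring_scope.

(* R^d with its Borel sigma-algebra. *)
Notation borelRV R d := (g_sigma_algebraType (@open 'rV[R]_d)).

Section Geometry.
Context {R : realType} {d : nat}.
Implicit Types (A B K : set 'rV[R]_d) (u x y : 'rV[R]_d).

Definition dot u x : R := (u *m x^T) 0 0.

(* The library's norm on 'rV[R]_d is the sup norm, so the Euclidean norm is
   introduced separately; the two induce the same topology. *)
Definition enorm x : R := Num.sqrt (dot x x).

Definition sphere : set 'rV[R]_d := [set u | enorm u = 1].

Definition convex_body K : Prop :=
  [/\ compact K, convex_set K & K° !=set0].

(* For a convex body the supremum is attained. *)
Definition support_fun K u : R := sup [set dot u x | x in K].

Definition cap K u (e : R) : set 'rV[R]_d :=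
  [set x | K x /\ support_fun K u - e <= dot u x].

Definition convex_hull A : set 'rV[R]_d :=
  smallest [set B : set 'rV[R]_d | convex_set B] A.

(* Euclidean Hausdorff distance; its value is +oo when A is unbounded and B is
   nonempty and bounded. *)
Definition hausdorff_dist A B : \bar R :=
  maxe (ereal_sup [set ereal_inf [set (enorm (x - y))%:E | y in B] | x in A])
       (ereal_sup [set ereal_inf [set (enorm (x - y))%:E | x in A] | y in B]).

End Geometry.

Section Probability.
Context {d d' : measure_display} {T : measurableType d}
  {T' : measurableType d'} {R : realType} (P : probability T R).
Local Open Scope ereal_scope.

(* Mutual independence of (Y i) for i in D: product rule over every finite
   subfamily. *)
Definition mutually_independent (I : choiceType) (D : set I)
    (Y : I -> {RV P >-> T'}) : Prop :=
  forall (J : {fset I}) (A : I -> set T'),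
    [set` J] `<=` D -> (forall i, measurable (A i)) ->
    P (\bigcap_(i in [set` J]) (Y i @^-1` A i)) =
    \prod_(i <- J) P (Y i @^-1` A i).

Definition sigma_of (I : Type) (D : set I) (Y : I -> {RV P >-> T'}) :
    set (set T) :=
  <<s \bigcup_(i in D) preimage_set_system setT (Y i) measurable >>.

(* Independence of the random element (Y i), i in D, from (Z j), j in E. *)
Definition independent_families (I J : Type) (D : set I) (E : set J)
    (Y : I -> {RV P >-> T'}) (Z : J -> {RV P >-> T'}) : Prop :=
  forall A B, sigma_of D Y A -> sigma_of E Z B -> P (A `&` B) = P A * P B.

Definition has_law (Y : {RV P >-> T'}) (mu : probability T' R) : Prop :=
  forall A, measurable A -> distribution P Y A = mu A.

(* Z_n = O_P(v_n) as n -> oo, for Z_n with values in [-oo, +oo]. The exceptional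
   event is measured with the outer measure [mu_ext P] induced by P, which
   agrees with P on measurable events, so that measurability of Z_n need not
   be assumed. The bound is required for all large n only: Z_n may be infinite
   with positive probability for small n. *)
Definition bigO_in_prob (Z : nat -> T -> \bar R) (v : nat -> R) : Prop :=
  forall eta : R, (0 < eta)%R -> exists2 A : R, (0 < A)%R &
    \forall n \near \oo,
      mu_ext P [set w | (A * v n)%:E < `|Z n w|] <= eta%:E.

End Probability.

(* The uniform distribution on the unit sphere: the (unique) Borel probability
   measure carried by the sphere that is invariant under the orthogonal
   group, i.e. the normalized surface measure. Vectors are rows, so an
   orthogonal matrix acts on the right. For d = 1 this is the law giving mass
   1/2 to each of the two points of the sphere. *)
Definition uniform_on_sphere (R : realType) (d : nat)
    (sigma : set (borelRV R d) -> \bar R) : Prop :=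
  sigma sphere = 1%E /\
  forall Q : 'M[R]_d, Q *m Q^T = 1%:M ->
  forall A : set (borelRV R d), measurable A ->
    sigma ((fun x : 'rV[R]_d => x *m Q) @^-1` A) = sigma A.

(* Sequences are indexed from 0, so X 0, ..., X (n - 1) stand for
   X_1, ..., X_n, and similarly for U. *)
Section RandomPolytopes.
Context {R : realType} {d : nat}.

Definition num_directions (C alpha : R) (n : nat) : nat :=
  `|Num.ceil (C * n%:R `^ ((d%:R - 1) / alpha)
                * ln n%:R `^ ((alpha - d%:R + 1) / alpha))|%N.

Definition sample_hull (X : nat -> 'rV[R]_d) (n : nat) : set 'rV[R]_d :=
  convex_hull [set X i | i in `I_n].

Definition outer_polytope (X U : nat -> 'rV[R]_d) (n M : nat) :
    set 'rV[R]_d :=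
  [set x | forall j, (j < M)%N ->
    ((dot (U j) x)%:E <= \big[maxe/-oo]_(i < n) (dot (U j) (X i))%:E)%E].

End RandomPolytopes.
Arguments num_directions {R} d C alpha n.

(* Main.v *)
Require Import Defs.
From HB Require Import structures.
From mathcomp Require Import all_boot all_order all_algebra finmap.
From mathcomp Require Import all_classical all_reals all_analysis.
From mathcomp Require Import ring lra.

Set Implicit Arguments.
Unset Strict Implicit.
Unset Printing Implicit Defensive.

Import Order.TTheory GRing.Theory Num.Theory.
Import numFieldNormedType.Exports.

Local Open Scope classical_set_scope.
Local Open Scope ring_scope.

(** The distance between the two polytopes is controlled by how densely the
    random directions fill the sphere, and the number [M n] of directions is
    just large enough for them to form a net of mesh of order
    [a_n = (ln n / n)^(1/alpha)] with probability tending to one.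

    Deterministic part ([hausdorff_outer_hull_le]).  Let the sample points lie
    in a ball of radius [rho] and let every unit vector be within [delta <= 1/2]
    of some [U j].  For [x] in the outer polytope let [y] be its projection on
    the hull, [r = |x - y|] and [u = (x - y) / r].  Pick [U j] close to [u] and
    [X k] maximal in direction [U j].  Then
      [r / 2 <= r <U j, u> = <U j, x - y> <= <U j, X k - y>
             <= <u, X k - y> + 2 rho delta <= 2 rho delta],
    the last step being the variational inequality of the projection.  Hence
    the Hausdorff distance is of order [rho * delta].  Approximate projections,
    which exist without a compactness argument, serve as well and cost a factor
    two ([near_projection]).

    Random part.  Radial projection of a grid on the surface of the cube gives
    a net of the sphere with [N = 2 d m^(d-1)] points and mesh [4 d / m]
    ([sphere_grid_net]).  By rotation invariance all balls of radius [4 d / m]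
    centred on the sphere have the same mass under the uniform law, so each has
    mass at least [1 / N] ([uniform_eball_ge]).  By independence some net point
    is missed by all [M] directions with probability at most
    [N (1 - 1/N)^M <= N exp (- M / N)] ([prob_net_failure_le]).

    With [m] the integer part of [1 / a_n], the definition of [M n] and the
    lower bound on [C] give [M n / N >= (d / alpha) ln n], while [N] is at most
    [2 d n^((d-1)/alpha)]; the failure probability is therefore at most
    [2 d n^(-1/alpha)] ([grid_failure_le]), which tends to zero.  Outside this
    event the net has mesh of order [a_n], and almost surely all the [X i] lie
    in the bounded set [K]. *)

(** * Euclidean norm and inner product *)

Section InnerProduct.
Context {R : realType} {d : nat}.
Implicit Types (x y z u v : 'rV[R]_d) (A : set 'rV[R]_d).

Lemma dotE x y : dot x y = \sum_i x 0 i * y 0 i.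
Proof. by rewrite /dot !mxE; apply: eq_bigr => i _; rewrite !mxE. Qed.

Lemma dotC x y : dot x y = dot y x.
Proof. by rewrite !dotE; apply: eq_bigr => i _; rewrite mulrC. Qed.

Lemma dotDl x y z : dot (x + y) z = dot x z + dot y z.
Proof. by rewrite /dot mulmxDl mxE. Qed.

Lemma dot0l x : dot 0 x = 0.
Proof. by rewrite /dot mul0mx mxE. Qed.

Lemma dotZl a x y : dot (a *: x) y = a * dot x y.
Proof. by rewrite /dot -scalemxAl mxE. Qed.

Lemma dotNl x y : dot (- x) y = - dot x y.
Proof. by rewrite -scaleN1r dotZl mulN1r. Qed.

Lemma dotBl x y z : dot (x - y) z = dot x z - dot y z.
Proof. by rewrite dotDl dotNl. Qed.

Lemma dotDr x y z : dot z (x + y) = dot z x + dot z y.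
Proof. by rewrite dotC dotDl !(dotC z). Qed.

Lemma dotZr a x y : dot x (a *: y) = a * dot x y.
Proof. by rewrite dotC dotZl dotC. Qed.

Lemma dotNr x y : dot x (- y) = - dot x y.
Proof. by rewrite dotC dotNl dotC. Qed.

Lemma dotBr x y z : dot z (x - y) = dot z x - dot z y.
Proof. by rewrite dotDr dotNr. Qed.

Definition dot_lin := (dotDl, dotDr, dotBl, dotBr, dotZl, dotZr, dotNl, dotNr).

Lemma dot_ge0 x : 0 <= dot x x.
Proof. by rewrite dotE sumr_ge0// => i _; rewrite -expr2 sqr_ge0. Qed.

Lemma dot0_eq x : dot x x = 0 -> x = 0.
Proof.
rewrite dotE => /eqP; rewrite psumr_eq0; last first.
  by move=> i _; rewrite -expr2 sqr_ge0.
move=> /allP x0; apply/rowP => i; rewrite !mxE.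
by have := x0 i (mem_index_enum _); rewrite /= mulf_eq0 orbb => /eqP.
Qed.

Lemma enorm_ge0 x : 0 <= enorm x. Proof. exact: sqrtr_ge0. Qed.

Lemma sqr_enorm x : enorm x ^+ 2 = dot x x.
Proof. by rewrite /enorm sqr_sqrtr// dot_ge0. Qed.

Lemma enorm0 : enorm (0 : 'rV[R]_d) = 0.
Proof. by rewrite /enorm dot0l sqrtr0. Qed.

Lemma enormZ a x : enorm (a *: x) = `|a| * enorm x.
Proof.
by rewrite /enorm dotZl dotZr mulrA -expr2 sqrtrM ?sqr_ge0// sqrtr_sqr.
Qed.

Lemma enormN x : enorm (- x) = enorm x.
Proof. by rewrite -scaleN1r enormZ normrN1 mul1r. Qed.

Lemma enormB x y : enorm (x - y) = enorm (y - x).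
Proof. by rewrite -enormN opprB. Qed.

Lemma enorm0_eq x : enorm x = 0 -> x = 0.
Proof. by move=> x0; apply: dot0_eq; rewrite -sqr_enorm x0 expr0n. Qed.

(** Cauchy-Schwarz: expanding [|b x - a y|^2 >= 0] with [a = |x|] and
    [b = |y|] gives [2 a b (a b - <x, y>) >= 0]. *)
Lemma dot_le_enorm x y : dot x y <= enorm x * enorm y.
Proof.
have [/eqP|ab0] := eqVneq (enorm x * enorm y) 0.
  rewrite mulf_eq0 => /orP[] /eqP /enorm0_eq ->.
    by rewrite dot0l enorm0 mul0r.
  by rewrite dotC dot0l enorm0 mulr0.
have {ab0}ab_gt0 : 0 < enorm x * enorm y.
  by rewrite lt_neqAle eq_sym ab0 mulr_ge0 ?enorm_ge0.
have := dot_ge0 (enorm y *: x - enorm x *: y).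
rewrite !dot_lin (dotC y x) -!sqr_enorm => h.
rewrite -(ler_pM2l ab_gt0); nra.
Qed.

Lemma ler_enormD x y : enorm (x + y) <= enorm x + enorm y.
Proof.
rewrite -(@ler_pXn2r _ 2)// ?nnegrE ?addr_ge0 ?enorm_ge0//.
rewrite sqr_enorm !dot_lin (dotC y x) -!sqr_enorm.
have := dot_le_enorm x y; nra.
Qed.

Lemma ler_enormB x y : enorm (x - y) <= enorm x + enorm y.
Proof. by rewrite -(enormN y) ler_enormD. Qed.

Lemma enorm_distD x y z : enorm (x - z) <= enorm (x - y) + enorm (y - z).
Proof. by rewrite (le_trans _ (ler_enormD _ _))// addrA subrK. Qed.

Lemma enorm_coord_le x (e : R) : 0 <= e ->
  (forall i, `|x 0 i| <= e) -> enorm x <= d%:R * e.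
Proof.
move=> e0 xe; rewrite -(@ler_pXn2r _ 2)// ?nnegrE ?mulr_ge0 ?enorm_ge0//.
rewrite sqr_enorm dotE (@le_trans _ _ (\sum_(i < d) e ^+ 2))//.
  apply: ler_sum => i _; rewrite -expr2 -real_normK ?num_real//.
  by rewrite ler_pXn2r ?nnegrE.
rewrite sumr_const card_ord -[leLHS]mulr_natl exprMn ler_wpM2r ?sqr_ge0//.
by rewrite -natrX ler_nat; case: (d) => // k; rewrite leq_pmull.
Qed.

Lemma coord_le_enorm x i : `|x 0 i| <= enorm x.
Proof.
rewrite -(@ler_pXn2r _ 2)// ?nnegrE ?enorm_ge0// sqr_enorm dotE.
rewrite real_normK ?num_real// (bigD1 i)//= -expr2 lerDl sumr_ge0// => j _.
by rewrite -expr2 sqr_ge0.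
Qed.

Lemma enorm_normalize x : x != 0 -> enorm ((enorm x)^-1 *: x) = 1.
Proof.
move=> x0; rewrite enormZ ger0_norm ?invr_ge0 ?enorm_ge0// mulVf//.
by apply: contra x0 => /eqP/enorm0_eq ->.
Qed.

(** The norm on the right is the sup norm, which carries the topology of
    ['rV[R]_d]; this comparison makes the Euclidean norm continuous. *)
Lemma enorm_le_norm x : enorm x <= d%:R * `|x|.
Proof.
apply: enorm_coord_le => // i; rewrite /Num.norm/= mx_normrE.
exact: (le_bigmax_cond 0 (fun ij => `|x ij.1 ij.2|) (j := (0, i))).
Qed.

Lemma continuous_enormB v : continuous (fun x => enorm (x - v)).
Proof.
move=> x; apply/(@cvgrPdist_le _ _ _ _ (nbhs_filter x)) => e e0; near=> y.
have /le_trans : `|enorm (x - v) - enorm (y - v)| <= enorm (x - y).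
  rewrite ler_norml; have := enorm_distD x y v; have := enorm_distD y x v.
  rewrite (enormB y x); lra.
apply; apply: (le_trans (enorm_le_norm _)).
have : `|x - y| < e / d.+1%:R.
  by near: y; apply: cvgr_dist_lt => //; rewrite divr_gt0.
rewrite ltr_pdivlMr// -natr1 => h; have := normr_ge0 (x - y); nra.
Unshelve. all: by end_near. Qed.

Lemma closed_eball v (r : R) : closed [set x | enorm (x - v) <= r].
Proof.
apply: (@closed_comp _ _ (fun x => enorm (x - v)) [set t : R | t <= r]).
  by move=> x _; exact: continuous_enormB.
exact: closed_le.
Qed.

Lemma convex_setP A : convex_set A <->
  forall x y (t : R), 0 <= t -> t <= 1 -> A x -> A y ->
    A (t *: x + (1 - t) *: y).
Proof.
split => [cA x y t t0 t1 /mem_set Ax /mem_set Ay|cA x y t].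
  exact/set_mem/(cA x y (Itv01 t0 t1)).
by move=> /set_mem Ax /set_mem Ay; apply/mem_set/cA.
Qed.

End InnerProduct.

(** * Outer polytopes along a net of directions *)

Section OuterPolytope.
Context {R : realType} {d : nat}.
Implicit Types (x y z u v : 'rV[R]_d) (A : set 'rV[R]_d).

(** The variational inequality of the projection of [x] on [A], up to [s].
    For a minimiser [y] of [|x - y|^2] up to [t s], comparison with the point
    [y + t (z - y)] of [A] gives
    [2 t <x - y, z - y> <= t s + t^2 r^2], and [t r^2 <= s] by choice of [t]. *)
Lemma near_projection A x (r s : R) : convex_set A -> A !=set0 ->
  (forall y z, A y -> A z -> enorm (z - y) <= r) -> 0 < s ->
  exists2 y, A y & forall z, A z -> dot (x - y) (z - y) <= s.
Proof.
move=> /convex_setP cA A0 Ar s0.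
pose t := s / (s + r ^+ 2).
have r2 : 0 <= r ^+ 2 := sqr_ge0 r.
have den : 0 < s + r ^+ 2 by lra.
have t0 : 0 < t by rewrite divr_gt0.
have tE : t * (s + r ^+ 2) = s by rewrite /t; field; lra.
have t1 : t <= 1 by rewrite ler_pdivrMr//; lra.
pose E := [set dot (x - y) (x - y) | y in A].
have lbE : has_lbound E by exists 0 => _ [y _ <-]; exact: dot_ge0.
have [_ [y Ay <-] yE] : exists2 e, E e & e < inf E + t * s.
  apply: inf_adherent; first exact: mulr_gt0.
  by split=> //; case: A0 => y Ay; exists (dot (x - y) (x - y)), y.
exists y => // z Az.
have := cA z y t (ltW t0) t1 Az Ay; set w := t *: z + _ => Aw.
have xwE : x - w = (x - y) - t *: (z - y).
  by rewrite /w; apply/rowP => i; rewrite !mxE; ring.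
have := ge_inf lbE (ex_intro2 _ _ w Aw erefl : E (dot (x - w) (x - w))).
have := Ar y z Ay Az => zyr.
have zyr2 : dot (z - y) (z - y) <= r ^+ 2.
  rewrite -sqr_enorm ler_pXn2r// ?nnegrE ?enorm_ge0//.
  by rewrite (le_trans _ zyr)// enorm_ge0.
rewrite xwE; move: (x - y) (z - y) yE zyr2 => a b yE zyr2.
rewrite !dot_lin (dotC b a) => h.
have h2 : t * dot a b * 2 <= t * s + t * (t * r ^+ 2).
  by have := ler_wpM2l (ltW t0) (ler_wpM2l (ltW t0) zyr2); lra.
have h3 : t * (t * r ^+ 2) <= t * s.
  by rewrite ler_pM2l//; nra.
by rewrite -(ler_pM2l t0); lra.
Qed.

Lemma convex_set_hull A : convex_set (convex_hull A).
Proof.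
apply/convex_setP => x y t t0 t1 Ax Ay B [cB AB].
by move/convex_setP: (cB); apply => //; [apply: Ax|apply: Ay].
Qed.

Lemma convex_eball v (r : R) : convex_set [set x | enorm (x - v) <= r].
Proof.
apply/convex_setP => x y t t0 t1 /= xr yr.
have -> : t *: x + (1 - t) *: y - v = t *: (x - v) + (1 - t) *: (y - v).
  by apply/rowP => i; rewrite !mxE; ring.
apply: (le_trans (ler_enormD _ _)); rewrite !enormZ !ger0_norm ?subr_ge0//.
by nra.
Qed.

Context (X U : nat -> 'rV[R]_d) (n M : nat).

Lemma sample_hullX i : (i < n)%N -> sample_hull X n (X i).
Proof. by move=> ilt; apply: sub_gen_smallest; exists i. Qed.

Lemma convex_outer_polytope : convex_set (outer_polytope X U n M).
Proof.
apply/convex_setP => x y t t0 t1 Ax Ay j jM.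
have := Ax j jM; have := Ay j jM.
set m := (\big[maxe/-oo]_(i < n) _)%E; rewrite !dot_lin.
case: m => [r||]//=; rewrite ?lee_fin ?leey// => xr yr; nra.
Qed.

Lemma sample_hull_sub_outer : sample_hull X n `<=` outer_polytope X U n M.
Proof.
apply: smallest_sub; first exact: convex_outer_polytope.
move=> _ [i /= ilt <-] j jM.
exact: (le_bigmax_cond _ (fun i : 'I_n => (dot (U j) (X i))%:E)
         (j := Ordinal ilt)).
Qed.

(** With [c = 8 rho delta] and a projection [y] of [x] on the hull exact up to
    [c^2 / 8], the assumption [r = |x - y| > c] yields
    [r / 2 <= c^2 / (8 r) + 2 rho delta < c / 8 + c / 4], a contradiction. *)
Lemma outer_polytope_near_hull (rho delta : R) : (0 < n)%N ->
  (forall i, (i < n)%N -> enorm (X i) <= rho) ->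
  0 < rho -> 0 < delta -> delta <= 2^-1 ->
  (forall u, sphere u -> exists2 j, (j < M)%N & enorm (U j - u) <= delta) ->
  forall x, outer_polytope X U n M x ->
  exists2 y, sample_hull X n y & enorm (x - y) <= 8 * rho * delta.
Proof.
move=> n0 Xrho rho0 delta0 delta12 Unet x Ox.
set c := 8 * rho * delta.
have c0 : 0 < c by rewrite /c !mulr_gt0.
have hull_rho : sample_hull X n `<=` [set y | enorm (y - 0) <= rho].
  apply: smallest_sub; first exact: convex_eball.
  by move=> _ [i ilt <-] /=; rewrite subr0 Xrho.
have hull_diam y z : sample_hull X n y -> sample_hull X n z ->
    enorm (z - y) <= 2 * rho.
  move=> /hull_rho/= + /hull_rho/=; rewrite !subr0 => yr zr.
  have := ler_enormB z y; lra.
have s0 : 0 < c ^+ 2 / 8 by rewrite divr_gt0 ?exprn_gt0.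
have [y Hy yproj] := near_projection x (@convex_set_hull _)
  (ex_intro _ _ (sample_hullX n0)) hull_diam s0.
exists y => //; rewrite leNgt; apply/negP => cr.
have r0 : 0 < enorm (x - y) by lra.
have xy0 : x - y != 0.
  apply/eqP => xy0; move: r0.
  by rewrite xy0 enorm0 ltxx.
have [j jM Uj] := Unet _ (enorm_normalize xy0).
set r := enorm (x - y) in cr r0 Uj.
set u := r^-1 *: (x - y) in Uj.
have xyE : x - y = r *: u by rewrite /u scalerA divff ?scale1r ?gt_eqF.
have u1 : enorm u = 1 by exact: enorm_normalize.
have uu1 : dot u u = 1 by rewrite -sqr_enorm u1 expr1n.
have [k Uk] : exists k : 'I_n, dot (U j) x <= dot (U j) (X k).
  have := Ox j jM.
  have [k _ ->] := @eq_bigmax _ _ _ (-oo%E) (Ordinal n0) xpredT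
    (fun i : 'I_n => (dot (U j) (X i))%:E) isT (fun i _ => leNye _).
  by rewrite lee_fin; exists k.
have HXk := sample_hullX (ltn_ord k).
(* Only [U j - u] is charged the diameter of the hull: along [u] itself the
   point [y] is almost maximal. *)
have upper : dot (U j) (x - y) <= r^-1 * (c ^+ 2 / 8) + delta * (2 * rho).
  have : dot (U j) (x - y) <= dot (U j) (X k - y) by rewrite !dot_lin; lra.
  move=> /le_trans; apply.
  rewrite -[in leLHS](subrK u (U j)) addrC dotDl; apply: lerD.
    rewrite /u dotZl ler_pM2l ?invr_gt0//; exact: yproj.
  apply: (le_trans (dot_le_enorm _ _)).
  by rewrite ler_pM ?enorm_ge0// hull_diam.
have lower : r / 2 <= dot (U j) (x - y).
  rewrite xyE dotZr ler_pM2l//.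
  have := dot_le_enorm (u - U j) u; rewrite u1 mulr1 dotBl uu1.
  rewrite enormB; lra.
have invc : r^-1 * (c ^+ 2 / 8) < c / 8.
  by rewrite mulrC ltr_pdivrMr//; nra.
rewrite /c in cr invc upper; lra.
Qed.

(** Since the hull is contained in the outer polytope, only the excess of the
    latter over the former contributes to the distance. *)
Lemma hausdorff_outer_hull_le (rho delta : R) : (0 < n)%N ->
  (forall i, (i < n)%N -> enorm (X i) <= rho) ->
  0 < rho -> 0 < delta -> delta <= 2^-1 ->
  (forall u, sphere u -> exists2 j, (j < M)%N & enorm (U j - u) <= delta) ->
  (`|hausdorff_dist (outer_polytope X U n M) (sample_hull X n)|
     <= (8 * rho * delta)%:E)%E.
Proof.
move=> n0 Xrho rho0 delta0 delta12 Unet.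
have c0 : 0 <= 8 * rho * delta by rewrite !mulr_ge0 ?ltW.
rewrite gee0_abs; last first.
  rewrite /hausdorff_dist le_max; apply/orP; left.
  apply: le_ereal_sup_tmp; have H0 := sample_hullX n0.
  eexists; first by exists (X 0%N) => //; exact: sample_hull_sub_outer.
  by apply: le_ereal_inf_tmp => _ [y _ <-]; rewrite lee_fin enorm_ge0.
rewrite /hausdorff_dist ge_max; apply/andP; split; apply: ge_ereal_sup.
  move=> _ [x Ox <-]; apply: ge_ereal_inf.
  have [y Hy xy] :=
    outer_polytope_near_hull n0 Xrho rho0 delta0 delta12 Unet Ox.
  by exists (enorm (x - y))%:E; [exists y|rewrite lee_fin].
move=> _ [y Hy <-]; apply: ge_ereal_inf; exists 0%E; last by rewrite lee_fin.
exists y; first exact: sample_hull_sub_outer.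
by rewrite subrr enorm0.
Qed.

End OuterPolytope.

(** * Nets of the sphere *)

Section SphereNet.
Context {R : realType}.

(** Multiplied by [|x| >= 1], the left-hand side is the norm of
    [(x - y) + ((|y| - |x|) / |y|) y], whose two terms are each at most
    [|x - y|] long. *)
Lemma normalize_dist d (x y : 'rV[R]_d) : 1 <= enorm x -> y != 0 ->
  enorm ((enorm x)^-1 *: x - (enorm y)^-1 *: y) <= 2 * enorm (x - y).
Proof.
move=> x1 y0.
have yn : enorm y != 0 by apply: contra y0 => /eqP/enorm0_eq ->.
have xgt0 : 0 < enorm x by lra.
have -> : (enorm x)^-1 *: x - (enorm y)^-1 *: y =
    (enorm x)^-1 *: ((x - y) + ((enorm y - enorm x) / enorm y) *: y).
  by apply/rowP => i; rewrite !mxE; field; rewrite yn gt_eqF.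
rewrite enormZ (ger0_norm (_ : 0 <= (enorm x)^-1)) ?invr_ge0 ?enorm_ge0//.
rewrite ler_pdivrMl//; apply: (le_trans (ler_enormD _ _)).
rewrite enormZ normrM normfV (ger0_norm (enorm_ge0 y)) mulrVK ?unitfE//.
have : `|enorm y - enorm x| <= enorm (x - y).
  have := enorm_distD x y 0; have := enorm_distD y x 0.
  rewrite !subr0 (enormB y) ler_norml; lra.
have := enorm_ge0 (x - y); nra.
Qed.

Lemma unit_interval_grid m (t : R) : (0 < m)%N -> 0 <= t <= 1 ->
  exists k : 'I_m, `|t - k%:R / m%:R| <= m%:R^-1.
Proof.
case: m => // m _ /andP[t0].
rewrite le_eqVlt => /predU1P[->|t1].
  (* The right end point is not of the form [k / m] with [k < m]. *)
  exists ord_max; rewrite (_ : 1 - _ = m.+1%:R^-1) ?ger0_norm ?invr_ge0//.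
  by rewrite /= -natr1; field; rewrite natr1.
have tm0 : 0 <= t * m.+1%:R by rewrite mulr_ge0.
have /andP[k1 k2] := truncn_itv tm0.
have kltm : (Num.Def.trunc (t * m.+1%:R) < m.+1)%N.
  by rewrite -(ltr_nat R) (le_lt_trans k1)// gtr_pMl.
exists (Ordinal kltm) => /=; move: k1 k2; set k := Num.Def.trunc _ => k1 k2.
rewrite -[t in `|t - _|](mulfK (_ : m.+1%:R != 0))// -mulrBl normrM.
rewrite (ger0_norm (_ : 0 <= m.+1%:R^-1)) ?invr_ge0//.
rewrite ger_pMl ?invr_gt0// ler_norml -natr1 in k2 *; lra.
Qed.

(** A face of the cube [[-1, 1]^(k+1)] is given by a coordinate [p.1.1] and a
    sign [p.1.2]; the grid [p.2] on it has only [k] free coordinates, which is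
    what makes the net below have the optimal order [m^k] of cardinality. *)
Definition cube_face_point k m (p : 'I_k.+1 * bool * {ffun 'I_k -> 'I_m}) :
    'rV[R]_k.+1 :=
  \row_j if unlift p.1.1 j is Some i then 2 * ((p.2 i)%:R / m%:R) - 1
         else (-1) ^+ p.1.2.

Definition sphere_grid k m (p : 'I_k.+1 * bool * {ffun 'I_k -> 'I_m}) :
    'rV[R]_k.+1 :=
  (enorm (cube_face_point p))^-1 *: cube_face_point p.

Lemma card_sphere_grid k m :
  #|{: 'I_k.+1 * bool * {ffun 'I_k -> 'I_m}}| = (2 * k.+1 * m ^ k)%N.
Proof. by rewrite !card_prod card_ffun !card_ord card_bool (mulnC 2). Qed.

Lemma cube_face_point_neq0 k m (p : 'I_k.+1 * bool * {ffun 'I_k -> 'I_m}) :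
  cube_face_point p != 0.
Proof.
apply/eqP => /rowP/(_ p.1.1); rewrite !mxE unlift_none => /eqP.
by rewrite signr_eq0.
Qed.

Lemma sphere_grid_sphere k m (p : 'I_k.+1 * bool * {ffun 'I_k -> 'I_m}) :
  sphere (sphere_grid p).
Proof. exact/enorm_normalize/cube_face_point_neq0. Qed.

(** Dividing [u] by its largest coordinate in absolute value puts it on the
    surface of the cube, outside the open unit ball, where a grid point is
    within [2 / m] in each coordinate; normalising back at most doubles the
    distance. *)
Lemma sphere_grid_net k m (u : 'rV[R]_k.+1) : (0 < m)%N -> sphere u ->
  exists p : 'I_k.+1 * bool * {ffun 'I_k -> 'I_m},
    enorm (u - sphere_grid p) <= 4 * k.+1%:R / m%:R.
Proof.
move=> m0 u1.
have [i _ imax] := @arg_maxP _ _ _ ord0 xpredT (fun i => `|u 0 i|) isT.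
have a0 : 0 < `|u 0 i|.
  rewrite normr_gt0; apply/eqP => ui0.
  have : enorm u <= k.+1%:R * 0.
    apply: enorm_coord_le => // j.
    by rewrite (le_trans (imax j _))// ui0 normr0.
  by rewrite mulr0 u1 ler10.
pose w : 'rV[R]_k.+1 := `|u 0 i|^-1 *: u.
have wj j : -1 <= w 0 j <= 1.
  rewrite -ler_norml mxE normrM normfV normr_id mulrC ler_pdivrMr// mul1r.
  exact: imax.
have wE : enorm w = `|u 0 i|^-1.
  by rewrite enormZ u1 mulr1 ger0_norm// invr_ge0.
have w1 : 1 <= enorm w.
  rewrite wE invf_ge1//; apply: (le_trans (coord_le_enorm _ _)).
  by rewrite u1.
have uE : u = (enorm w)^-1 *: w.
  by rewrite wE invrK scalerA divff ?scale1r// gt_eqF.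
have grid (j : 'I_k) : exists l : 'I_m,
    `|(w 0 (lift i j) + 1) / 2 - l%:R / m%:R| <= m%:R^-1.
  apply: unit_interval_grid => //; have := wj (lift i j); lra.
have [h hP] := choice grid; pose f := [ffun j => h j].
exists (i, u 0 i < 0, f).
rewrite {1}uE (le_trans (normalize_dist w1 (cube_face_point_neq0 _)))//.
have e0 : 0 <= m%:R^-1 :> R by rewrite invr_ge0.
rewrite (_ : 4 * _ / _ = 2 * (k.+1%:R * (2 / m%:R))); last by ring.
rewrite ler_pM2l//; apply: enorm_coord_le => [|j]; first by rewrite mulr_ge0.
rewrite !mxE; case: unliftP => [l ->|->] /=.
  have := hP l; rewrite ffunE mxE.
  by rewrite !ler_norml; set y := _^-1 * _; set z := _ / m%:R; lra.
have -> : `|u 0 i|^-1 * u 0 i = (-1) ^+ (u 0 i < 0)%R.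
  have ui0 : u 0 i != 0 by rewrite -normr_gt0.
  case: ltP => ui; first by rewrite ltr0_norm// invrN mulNr mulVf.
  by rewrite ger0_norm// mulVf.
by rewrite subrr normr0; lra.
Qed.

End SphereNet.

(** * The uniform distribution and random nets *)

Lemma measure_bigcup_fin_le disp (T : measurableType disp) (R : realType)
    (mu : {measure set T -> \bar R}) (I : finType) (F : I -> set T) (c : R) :
  (forall i, measurable (F i)) -> (forall i, (mu (F i) <= c%:E)%E) ->
  (mu (\bigcup_i F i) <= (#|I|%:R * c)%:E)%E.
Proof.
move=> mF Fc; rewrite (_ : setT = [set` enum I]); last first.
  by apply/seteqP; split => i //= _; rewrite mem_enum.
rewrite bigcup_seq cardE; elim: (enum I) => [|i s IHs].
  by rewrite big_nil measure0 mul0r.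
rewrite big_cons (le_trans (measureU2 _ _ _))//.
  exact: bigsetU_measurable.
by rewrite /= -nat1r mulrDl mul1r EFinD leeD.
Qed.

Section UniformOnSphere.
Context {R : realType} {d : nat}.

Lemma closed_borel (A : set 'rV[R]_d) :
  closed A -> measurable (A : set (borelRV R d)).
Proof.
move=> cA; rewrite -(setCK A); apply: measurableC.
by apply: sub_sigma_algebra; exact: closed_openC.
Qed.

Definition eball (v : 'rV[R]_d) (r : R) : set (borelRV R d) :=
  [set x : 'rV[R]_d | enorm (x - v) <= r].

Lemma measurable_eball v r : measurable (eball v r).
Proof. by apply: closed_borel; exact: closed_eball. Qed.

Lemma measurable_sphere : measurable (@sphere R d : set (borelRV R d)).
Proof.
apply: closed_borel.
have -> : @sphere R d = (fun x => enorm (x - 0)) @^-1` [set t | t = 1].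
  by apply/seteqP; split => x; rewrite /sphere /= subr0.
apply: closed_comp => [x _|]; [exact: continuous_enormB|exact: closed_eq].
Qed.

(** The Householder reflection in the hyperplane orthogonal to [u - v]
    exchanges [u] and [v]. *)
Lemma orthogonal_transitive (u v : 'rV[R]_d) : sphere u -> sphere v ->
  exists2 Q : 'M[R]_d, Q *m Q^T = 1%:M & u *m Q = v.
Proof.
move=> u1 v1; have [->|uv] := eqVneq u v.
  by exists 1%:M; rewrite ?trmx1 mulmx1.
set w := u - v; pose c := 2 / dot w w.
have ww0 : dot w w != 0.
  by apply: contra uv => /eqP/dot0_eq/eqP; rewrite subr_eq0.
have wwE : w *m w^T = (dot w w)%:M by rewrite [LHS]mx11_scalar.
have QT : (1%:M - c *: (w^T *m w))^T = 1%:M - c *: (w^T *m w).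
  by rewrite raddfB/= trmx1 linearZ/= trmx_mul trmxK.
have WW : (w^T *m w) *m (w^T *m w) = dot w w *: (w^T *m w).
  by rewrite mulmxA -(mulmxA w^T w) wwE mul_mx_scalar scalemxAl.
exists (1%:M - c *: (w^T *m w)).
  rewrite QT; move: (w^T *m w) WW => W WW.
  rewrite mulmxBl mul1mx mulmxBr mulmx1 -scalemxAl -scalemxAr WW !scalerA.
  rewrite -addrA -opprD; apply/eqP; rewrite subr_eq addrC -subr_eq subrr eq_sym.
  rewrite addrA -scalerDl -scalerBl (_ : _ - _ = 0) ?scale0r//.
  by rewrite /c; field.
have uw : dot u w = dot w w / 2.
  have := sqr_enorm u; have := sqr_enorm v.
  rewrite /w !dot_lin u1 v1 (dotC v u).
  by move=> <- <-; field.
rewrite mulmxBr mulmx1 -scalemxAr mulmxA [u *m w^T]mx11_scalar -/(dot u w).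
rewrite mul_scalar_mx scalerA uw (_ : _ * _ = 1); last by rewrite /c; field.
by rewrite scale1r /w opprB addrC subrK.
Qed.

Lemma enorm_orthogonal (Q : 'M[R]_d) (x : 'rV[R]_d) :
  Q *m Q^T = 1%:M -> enorm (x *m Q) = enorm x.
Proof.
by move=> QQ; rewrite /enorm /dot trmx_mul mulmxA -(mulmxA x) QQ mulmx1.
Qed.

Context (sigma : probability (borelRV R d) R).
Context (sigma_unif : uniform_on_sphere sigma).

Lemma uniform_eball_eq (u v : 'rV[R]_d) r : sphere u -> sphere v ->
  sigma (eball u r) = sigma (eball v r).
Proof.
move=> u1 v1; have [Q QQ uQ] := orthogonal_transitive u1 v1.
rewrite -(sigma_unif.2 Q QQ _ (measurable_eball v r)); congr (sigma _).
apply/seteqP; split => x; rewrite /eball/= -uQ -mulmxBl enorm_orthogonal//.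
Qed.

(** The balls around a net cover the sphere, which has mass one, and they all
    have the same mass by rotation invariance. *)
Lemma uniform_eball_ge (I : finType) (g : I -> 'rV[R]_d) (r : R) :
  (forall i, sphere (g i)) ->
  (forall u, sphere u -> exists i, enorm (u - g i) <= r) ->
  forall i, ((#|I|%:R^-1)%:E <= sigma (eball (g i) r))%E.
Proof.
move=> g1 gnet i.
have I0 : 0 < #|I|%:R :> R by rewrite ltr0n; apply/card_gt0P; exists i.
have fin : sigma (eball (g i) r) \is a fin_num.
    by apply: fin_num_measure; exact: measurable_eball.
have sub : (sigma sphere <= sigma (\bigcup_j eball (g j) r))%E.
  apply: le_measure; rewrite ?inE.
  - exact: measurable_sphere.
  - by apply: fin_bigcup_measurable => // j _; exact: measurable_eball.
  - by move=> u /gnet[j uj]; exists j.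
have : (sigma (\bigcup_j eball (g j) r) <=
    (#|I|%:R * fine (sigma (eball (g i) r)))%:E)%E.
  apply: measure_bigcup_fin_le => j; first exact: measurable_eball.
  by rewrite fineK// -(uniform_eball_eq r (g1 j) (g1 i)).
move=> /(le_trans sub); rewrite sigma_unif.1 lee_fin => le1.
by rewrite -(fineK fin) lee_fin -div1r ler_pdivrMr// mulrC.
Qed.

End UniformOnSphere.

Section NetFailure.
Context {R : realType} {d : nat} {disp : measure_display}.
Context {T : measurableType disp} (P : probability T R).
Context (U : nat -> {RV P >-> borelRV R d}) (M : nat).
Context (U_indep : mutually_independent `I_M U).
Context (U_unif :
  forall j, (j < M)%N -> uniform_on_sphere (distribution P (U j))).

(** By independence the probability is at most [(1 - p)^M <= exp (- p M)]. *)
Lemma prob_all_miss_le (A : set (borelRV R d)) (p : R) : p <= 1 ->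
  measurable A ->
  (forall j, (j < M)%N -> (p%:E <= P (U j @^-1` A))%E) ->
  (P (\bigcap_(j in `I_M) U j @^-1` (~` A)) <= (expR (- (p * M%:R)))%:E)%E.
Proof.
move=> p1 mA pA; pose J := [fset j in iota 0 M]%fset.
have JE : [set` J] = `I_M.
  by apply/seteqP; split => j /=; rewrite !inE mem_iota/= add0n.
have mU j : measurable (U j @^-1` A) by exact: measurable_funPTI.
rewrite -JE (U_indep (A := fun=> ~` A)); first last.
- by move=> j; exact: measurableC.
- by rewrite JE.
rewrite (eq_bigr (fun j => (fine (P (U j @^-1` (~` A))))%:E)); last first.
  move=> j _; rewrite fineK// fin_num_measure// -preimage_setC.
  exact: measurableC.
rewrite prodEFin lee_fin big_seq.
apply: (@le_trans _ _ (\prod_(j <- J | j \in J) expR (- p))).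
  apply: ler_prod => j; rewrite !inE mem_iota /= add0n => jM.
  rewrite fine_ge0//= -lee_fin fineK; last first.
    by rewrite fin_num_measure// -preimage_setC; exact: measurableC.
  rewrite -preimage_setC probability_setC// (@le_trans _ _ (1 - p)%:E)//.
    by rewrite EFinB leeB// pA.
  by rewrite lee_fin expR_ge1Dx.
rewrite -big_seq big_const_seq count_predT iter_mulr_1 -expRM_natr mulNr.
by rewrite -/(#|` J|) /J card_fseq undup_id ?iota_uniq// size_iota.
Qed.

(** Hitting every ball of a deterministic net is a finite conjunction, hence a
    measurable event, and forces the directions to be a net themselves. *)
Definition net_failure (I : finType) (g : I -> 'rV[R]_d) (r : R) : set T :=
  \bigcup_i \bigcap_(j in `I_M) U j @^-1` (~` eball (g i) r).

Lemma measurable_net_failure (I : finType) (g : I -> 'rV[R]_d) r :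
  measurable (net_failure g r).
Proof.
apply: fin_bigcup_measurable => // i _; apply: fin_bigcap_measurable => // j _.
by apply: measurable_funPTI; apply: measurableC; exact: measurable_eball.
Qed.

Lemma prob_net_failure_le (I : finType) (g : I -> 'rV[R]_d) (r : R) :
  (forall i, sphere (g i)) ->
  (forall u, sphere u -> exists i, enorm (u - g i) <= r) ->
  (P (net_failure g r) <= (#|I|%:R * expR (- (#|I|%:R^-1 * M%:R)))%:E)%E.
Proof.
move=> g1 gnet; apply: measure_bigcup_fin_le => i.
  apply: fin_bigcap_measurable => // j _.
  by apply: measurable_funPTI; apply: measurableC; exact: measurable_eball.
have I0 : (0 < #|I|)%N by apply/card_gt0P; exists i.
apply: prob_all_miss_le.
- by rewrite invf_le1 ?ler1n ?ltr0n.
- exact: measurable_eball.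
- by move=> j jM; have := uniform_eball_ge (U_unif jM) g1 gnet i.
Qed.

Lemma net_of_not_failure (I : finType) (g : I -> 'rV[R]_d) (r : R) w :
  (forall u, sphere u -> exists i, enorm (u - g i) <= r) ->
  ~ net_failure g r w ->
  forall u, sphere u -> exists2 j, (j < M)%N & enorm (U j w - u) <= r + r.
Proof.
move=> gnet wF u /gnet[i ui]; apply: contrapT => no; apply: wF.
exists i => // j jM /= Uj; apply: no; exists j => //.
by rewrite (le_trans (enorm_distD _ (g i) _))// lerD// enormB.
Qed.

End NetFailure.

(** * Rate of convergence and number of directions *)

Section Rate.
Context {R : realType}.
Implicit Types (alpha C : R) (n : nat).

Definition rate alpha n : R := (ln n%:R / n%:R) `^ alpha^-1.

Lemma natr_expR_ln n : (0 < n)%N -> n%:R = expR (ln n%:R) :> R.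
Proof. by move=> n0; rewrite lnK// posrE ltr0n. Qed.

Lemma rateE alpha n : (0 < n)%N -> 0 < ln n%:R :> R ->
  rate alpha n = expR ((ln (ln n%:R) - ln n%:R) / alpha).
Proof.
move=> n0 l0; rewrite /rate expRM expRB -natr_expR_ln//.
by rewrite lnK ?posrE.
Qed.

(** The exponents in the number of directions are those of
    [ln n * (n / ln n)^(k / alpha)], that is of [ln n] times the order of the
    number of points in a net of mesh [rate alpha n]. *)
Lemma num_directions_ge alpha C k n : 0 < alpha -> (0 < n)%N ->
  0 < ln n%:R :> R ->
  C * ln n%:R * (rate alpha n)^-1 ^+ k <= (num_directions k.+1 C alpha n)%:R.
Proof.
move=> alpha0 n0 l0; rewrite /num_directions.
set y := C * _ `^ _ * _.
have -> : C * ln n%:R * (rate alpha n)^-1 ^+ k = y.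
  rewrite /y rateE// -expRN -expRM_natr -!(mulrA C); congr (_ * _).
  set L : R := ln n%:R; have lE : L = expR (ln L) by rewrite lnK ?posrE.
  have NE : n%:R = expR L :> R by exact: natr_expR_ln.
  rewrite NE [X in _ = _ * X `^ _]lE [X in X * _ = _]lE -!expRM -!expRD.
  congr expR.
  by rewrite -natr1; field; rewrite gt_eqF.
apply: (le_trans (ceil_ge y)).
by rewrite natr_absz ler_int ler_norm.
Qed.

(** In dimension [D = k + 1], writing [L = ln n] and [B] for the [k]-th power of
    the inverse rate: [N <= 2 D B] and the number of directions is at least
    [C L B], so the exponent is at least [C L / (2 D) >= L D / alpha].  It
    outweighs [B <= exp (L k / alpha)] by [exp (- L / alpha)]. *)
Lemma grid_failure_le alpha C k n m : 0 < alpha ->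
  2 * alpha^-1 * k.+1%:R ^+ 2 <= C -> (0 < n)%N -> 1 <= ln n%:R :> R ->
  (0 < m)%N -> m%:R <= (rate alpha n)^-1 ->
  forall N : R, N = (2 * k.+1 * m ^ k)%:R ->
  N * expR (- (N^-1 * (num_directions k.+1 C alpha n)%:R)) <=
  2 * k.+1%:R * expR (- (ln n%:R / alpha)).
Proof.
move=> alpha0 hC n0 l1 m0 mb N NE.
have l0 : 0 < ln n%:R :> R by lra.
set L : R := ln n%:R in l1 l0 *; set D : R := k.+1%:R.
have D0 : 0 < D by rewrite ltr0n.
pose B : R := (rate alpha n)^-1 ^+ k.
have B0 : 0 < B by rewrite exprn_gt0// invr_gt0 rateE// expR_gt0.
have N0 : 0 < N by rewrite NE ltr0n !muln_gt0 expn_gt0 m0.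
have NB : N <= 2 * D * B.
  rewrite NE !natrM natrX ler_pM2l ?mulr_gt0//.
  by rewrite lerXn2r// nnegrE ?ler0n// invr_ge0 powR_ge0.
have BL : B <= expR (L * (k%:R / alpha)).
  rewrite /B rateE// -expRN -expRM_natr ler_expR -/L.
  rewrite (_ : _ * _ = (L - ln L) * (k%:R / alpha)); last by ring.
  by rewrite ler_wpM2r ?divr_ge0// ?(ltW alpha0)// gerBl ln_ge0.
have LN : L * (D / alpha) <= N^-1 * (num_directions k.+1 C alpha n)%:R.
  rewrite ler_pdivlMl//; apply: le_trans (num_directions_ge C k alpha0 n0 l0).
  have LD : 0 <= L * (D / alpha) by rewrite mulr_ge0 ?divr_ge0// ltW.
  rewrite (le_trans (ler_wpM2r LD NB))// -/B -/L.
  rewrite (_ : 2 * D * B * (L * (D / alpha)) = 2 * alpha^-1 * D ^+ 2 * (L * B)).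
    by rewrite -[leRHS]mulrA ler_wpM2r// mulr_ge0// ltW.
  by ring.
apply: (@le_trans _ _
  (2 * D * expR (L * (k%:R / alpha)) * expR (- (L * (D / alpha))))).
  apply: ler_pM; rewrite ?(ltW N0) ?expR_ge0//.
    by rewrite (le_trans NB)// ler_pM2l// mulr_gt0.
  by rewrite ler_expR lerN2.
rewrite -mulrA -expRD (_ : _ + _ = - (L / alpha))//.
by rewrite /D -natr1; ring.
Qed.

(** [n = exp (ln n) >= (ln n)^2 / 2], hence [ln n / n <= 2 / ln n]. *)
Lemma rate_le alpha n (theta : R) : 0 < alpha -> 0 < theta -> (0 < n)%N ->
  2 / theta `^ alpha <= ln n%:R -> rate alpha n <= theta.
Proof.
move=> alpha0 theta0 n0; set L : R := ln n%:R.
have ta0 : 0 < theta `^ alpha by rewrite powR_gt0.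
rewrite ler_pdivrMr// => hL.
have L0 : 0 < L.
  by rewrite -(pmulr_lgt0 _ ta0) (lt_le_trans _ hL).
have hN : 1 + L ^+ 2 / 2 <= n%:R.
  have := @expR_ge1Dxn _ L 1 (ltW L0).
  by rewrite -natr_expR_ln.
have -> : theta = (theta `^ alpha) `^ alpha^-1.
  by rewrite -powRrM divff ?gt_eqF// powRr1// ltW.
have N0 : 0 < n%:R :> R by rewrite ltr0n.
have LN : L / n%:R <= theta `^ alpha by rewrite ler_pdivrMr//; nra.
apply: ge0_ler_powR => //; rewrite ?nnegrE ?invr_ge0; first exact: ltW.
  by rewrite divr_ge0// ltW.
exact: ltW.
Qed.

Lemma near_ln_ge (y : R) : \forall n \near \oo, y <= ln n%:R.
Proof.
near=> n.
have h : expR y <= n%:R by near: n; exact: nbhs_infty_ger.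
have n0 : 0 < n%:R :> R by rewrite (lt_le_trans (expR_gt0 y)).
by rewrite -ler_expR lnK// posrE.
Unshelve. all: by end_near. Qed.

End Rate.

(** * Convergence in probability *)

Lemma compact_enorm_bounded (R : realType) d (K : set 'rV[R]_d) : compact K ->
  exists2 rho : R, 0 < rho & forall x, K x -> enorm x <= rho.
Proof.
move=> /compact_bounded[B [_ KB]].
exists (d%:R * (`|B| + 1) + 1) => [|x Kx].
  by rewrite ltr_pwDr ?mulr_ge0 ?addr_ge0.
rewrite (le_trans (enorm_le_norm x))// ler_wpDr// ler_wpM2l//.
by apply: KB => //; have := ler_norm B; lra.
Qed.

Lemma has_law_notin_negligible disp disp' (T : measurableType disp)
    (T' : measurableType disp') (R : realType) (P : probability T R)
    (Y : {RV P >-> T'}) (mu : probability T' R) (K : set T') :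
  has_law Y mu -> measurable K -> mu K = 1%E -> P (Y @^-1` (~` K)) = 0%E.
Proof.
move=> Ymu mK muK.
rewrite -preimage_setC probability_setC; last exact: measurable_funPTI.
have -> : P (Y @^-1` K) = 1%E by rewrite -muK -(Ymu K mK).
by rewrite subee.
Qed.

Theorem corollary3 (R : realType) (d : nat) (hd : (0 < d)%N)
    (disp : measure_display) (Omega : measurableType disp)
    (P : probability Omega R)
    (K : set 'rV[R]_d) (hK : convex_body K)
    (mu : probability (borelRV R d) R) (hmuK : mu K = 1%E)
    (X : nat -> {RV P >-> borelRV R d})
    (hXindep : mutually_independent setT X)
    (hXlaw : forall i : nat, has_law (X i) mu)
    (alpha L eps0 : R) (halpha : 0 < alpha) (hL : 0 < L)
    (heps0 : 0 < eps0) (heps01 : eps0 <= 1)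
    (hmu : forall u : 'rV[R]_d, sphere u ->
      forall eps : R, 0 <= eps -> eps <= eps0 ->
        ((L * eps `^ alpha)%:E <= mu (cap K u eps))%E)
    (C : R) (hC : 2 * alpha^-1 * d%:R ^+ 2 * 8 `^ ((d%:R - 1) / 2) < C)
    (M : nat -> nat)
    (hM : forall n : nat, (2 <= n)%N -> M n = num_directions d C alpha n)
    (U : nat -> nat -> {RV P >-> borelRV R d})
    (hUindep : forall n : nat, (2 <= n)%N ->
      mutually_independent `I_(M n) (U n))
    (hUlaw : forall n : nat, (2 <= n)%N -> forall j : nat, (j < M n)%N ->
      uniform_on_sphere (distribution P (U n j)))
    (hXU : forall n : nat, (2 <= n)%N ->
      independent_families `I_n `I_(M n) X (U n)) :
  bigO_in_prob P
    (fun (n : nat) (w : Omega) =>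
      hausdorff_dist
        (outer_polytope (fun i => X i w) (fun j => U n j w) n (M n))
        (sample_hull (fun i => X i w) n))
    (fun n : nat => (ln n%:R / n%:R) `^ alpha^-1).
Proof.
case: d hd K hK mu hmuK X hXindep hXlaw hmu hC hM U hUindep hUlaw hXU => // k _.
move=> K [Kcompact _ _] mu muK X _ Xmu _ hC hM U U_indep U_unif _.
set D : R := k.+1%:R in hC.
have D0 : 0 < D by rewrite ltr0n.
have C_ge : 2 * alpha^-1 * D ^+ 2 <= C.
  apply: le_trans (ltW hC); apply: ler_peMr.
    by rewrite !mulr_ge0 ?invr_ge0 ?(ltW halpha) ?(ltW D0).
  by rewrite -[leLHS](powRr0 8) ler_powR ?ler1n// divr_ge0// subr_ge0 ler1n.
have mK : measurable (K : set (borelRV R k.+1)).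
  by apply: closed_borel; apply: compact_closed => //; exact: norm_hausdorff.
have [rho rho0 Krho] := compact_enorm_bounded Kcompact.
move=> eta eta0; exists (128 * rho * D); first by rewrite !mulr_gt0.
(* A rate below this value gives [m > 16 d], hence a mesh of at most 1/2. *)
have theta0 : 0 < (16 * D + 1)^-1 by rewrite invr_gt0 addr_gt0 ?mulr_gt0.
near=> n.
have n2 : (2 <= n)%N by near: n; exact: nbhs_infty_ge.
have n0 : (0 < n)%N by exact: ltn_trans n2.
have l1 : 1 <= ln n%:R :> R by near: n; exact: near_ln_ge.
have rate_small : rate alpha n <= (16 * D + 1)^-1.
  by apply: rate_le => //; near: n; exact: near_ln_ge.
have eta_large : 2 * D * expR (- (ln n%:R / alpha)) <= eta.
  rewrite -ler_pdivlMl ?mulr_gt0// -ler_ln ?posrE ?expR_gt0//; last first.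
    by rewrite mulr_gt0 ?invr_gt0 ?mulr_gt0.
  rewrite expRK lerNl ler_pdivlMr//.
  by near: n; exact: near_ln_ge.
have rate0 : 0 < rate alpha n by rewrite rateE ?expR_gt0//; lra.
set b := (rate alpha n)^-1.
have b_large : 16 * D + 1 <= b by rewrite -[leLHS]invrK lef_pV2 ?posrE.
have b0 : 0 <= b by lra.
pose m := Num.Def.trunc b.
have /andP[mb bm] : m%:R <= b < m.+1%:R := truncn_itv b0.
rewrite -natr1 in bm.
have D1 : 1 <= D by rewrite ler1n.
have m1 : 16 * D < m%:R by lra.
have m0 : (0 < m)%N by rewrite -(ltr_nat R); lra.
(* The directions approximate the grid, and the grid the sphere, each within
   [4 D / m]. *)
pose delta := 4 * D / m%:R + 4 * D / m%:R.
have mR0 : 0 < m%:R :> R by rewrite ltr0n.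
have delta0 : 0 < delta by rewrite addr_gt0// divr_gt0// mulr_gt0.
have delta12 : delta <= 2^-1.
  rewrite /delta -mulrDl ler_pdivrMr//; lra.
have deltaE : 8 * rho * delta <= 128 * rho * D * rate alpha n.
  have -> : 8 * rho * delta = 64 * rho * D / m%:R by rewrite /delta; ring.
  have brate : b * rate alpha n = 1 by rewrite mulVf// gt_eqF.
  have ratem : 1 <= 2 * (rate alpha n * m%:R) by nra.
  have c0 : 0 <= 64 * rho * D by rewrite !mulr_ge0// ltW.
  rewrite ler_pdivrMr//; have := ler_wpM2l c0 ratem; lra.
pose I := ('I_k.+1 * bool * {ffun 'I_k -> 'I_m})%type.
pose g : I -> 'rV[R]_k.+1 := @sphere_grid R k m.
have gnet u : sphere u -> exists i, enorm (u - g i) <= 4 * D / m%:R.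
  by move=> u1; exact: sphere_grid_net.
pose badU := net_failure (U n) (M n) g (4 * D / m%:R).
pose badX := \bigcup_(i : 'I_n) X i @^-1` (~` K).
have mX i : measurable (X i @^-1` (~` K)).
  by apply: measurable_funPTI; exact: measurableC.
have mbadU : measurable badU by exact: measurable_net_failure.
have mbadX : measurable badX by apply: fin_bigcup_measurable.
have PbadU : (P badU <= eta%:E)%E.
  have := prob_net_failure_le (U_indep n n2) (U_unif n n2)
    (@sphere_grid_sphere R k m) gnet.
  move=> /le_trans; apply; rewrite lee_fin; apply: le_trans eta_large.
  rewrite hM// card_sphere_grid.
  exact: (grid_failure_le halpha C_ge n0 l1 m0 mb erefl).
have PbadX : (P badX <= 0%:E)%E.
  rewrite -(mulr0 #|'I_n|%:R); apply: measure_bigcup_fin_le => // i.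
  by rewrite [leLHS](has_law_notin_negligible (Xmu i) mK muK).
apply: (@le_trans _ _ (mu_ext P (badX `|` badU))).
  apply: le_mu_ext => w /= Zw; apply: contrapT => /not_orP[nX nU].
  move: Zw; apply/negP; rewrite -leNgt.
  apply: (@le_trans _ _ (8 * rho * delta)%:E); last by rewrite lee_fin.
  apply: hausdorff_outer_hull_le => //.
    move=> i iltn; apply: Krho; apply: contrapT => nK; apply: nX.
    by exists (Ordinal iltn).
  exact: (net_of_not_failure gnet nU).
rewrite measurable_mu_extE; last exact: measurableU.
rewrite (le_trans (measureU2 _ _ _))// -[leRHS]add0e; exact: leeD.
Unshelve. all: by end_near. Qed.
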